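(* Let $B^{(1)},B^{(2)}\in\mathcal B$ be one-sided banded matrices and suppose that $$\big|B^{(1)}_{n+i,n+j}-B^{(2)}_{n+i,n+j}\big|\to0\qquad\text{as }n\to\infty,$$ for any fixed $i,j\in\{1,2,\dots\}$. Then, for any fixed $m=2,3,\dots$, $$\big|C^{(n)}_m(B^{(1)})-C^{(n)}_m(B^{(2)})\big|\to0\qquad\text{as }n\to\infty.$$
   Context: $\mathcal B$ is the space of infinite matrices $B=(B_{i,j})_{i,j=1}^\infty$ for which there exists $b>0$ (depending on $B$) such that $B_{ij}=0$ for $j>i+b$; it is closed under addition and matrix multiplication. $P_n$ is the projection onto the first $n$ coordinates, $P_n(x_1,x_2,\dots)^T=(x_1,\dots,x_n,0,0,\dots)^T$. For $B\in\mathcal B$ and $m\ge1$, $$C^{(n)}_m(B)=m!\sum_{j=1}^m\frac{(-1)^{j+1}}j\sum_{\substack{l_1+\dots+l_j=m\\ l_i\ge1}}\frac{\operatorname{Tr}\big(P_nB^{l_1}P_nB^{l_2}P_n\cdots P_nB^{l_j}P_n\big)}{l_1!\cdots l_j!}.$$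
   Formalization: The formal theorem adds that for each fixed i, j the sequence B^{(1)}_{n+i,n+j} is bounded in n; without it the claim fails, e.g. zero-diagonal Jacobi matrices with off-diagonals n and n+1/n, where the C_2 difference tends to 2. *)

(* Defs.v *)
From mathcomp Require Import all_boot all_order all_algebra.
From mathcomp Require Import all_classical all_reals all_analysis.
Set Implicit Arguments.
Unset Strict Implicit.
Unset Printing Implicit Defensive.
Import Order.TTheory GRing.Theory Num.Theory numFieldNormedType.Exports.
Local Open Scope classical_set_scope.
Local Open Scope ring_scope.

(* Infinite matrices over a numFieldType K, which covers both the real and the
   complex numbers. Indices start at 0: the entry (i, j) here is the entry
   (i.+1, j.+1) of the usual 1-based convention. *)
Definition infmx (K : Type) := nat -> nat -> K.

Section InfiniteMatrices.
Context {K : numFieldType}.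
Implicit Types A B : infmx K.

Definition one_sided_banded B :=
  exists2 b : nat, (0 < b)%N & forall i j : nat, (i + b < j)%N -> B i j = 0.

(* Each diagonal of B is bounded; the bound may depend on the diagonal. Without
   this, asymptotically close entries do not give asymptotically close products:
   cumulant n 2 of the Jacobi matrix with zero diagonal and off-diagonal entries
   a_1, a_2, ... is a_n ^ 2, and a_n = n and a_n = n + 1 / n are asymptotically
   close whereas the difference of their squares tends to 2. *)
Definition bounded_diagonals B :=
  forall i j : nat, exists M : K, forall n : nat, `|B (n + i)%N (n + j)%N| <= M.

(* The sums over nat are those of fsbigop (sums over the support when it is
   finite, 0 otherwise). Whenever the left factor is one-sided banded, the
   support is finite, see infmx_mulE and infmx_tr_trunc. *)
Definition infmx_mul A B : infmx K :=
  fun i j => \sum_(k \in [set: nat]) (A i k * B k j).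

Definition infmx_tr A : K := \sum_(k \in [set: nat]) A k k.

Definition infmx_one : infmx K := fun i j => (i == j)%:R.

Definition infmx_exp B (l : nat) : infmx K := iterop l infmx_mul B infmx_one.

Definition trunc (n : nat) : infmx K := fun i j => ((i == j) && (i < n)%N)%:R.

(* trunc_prod n B [:: l1; ...; lj] = P_n B^l1 P_n B^l2 P_n ... P_n B^lj P_n *)
Definition trunc_prod (n : nat) B (ls : seq nat) : infmx K :=
  foldr (fun l M => infmx_mul (trunc n) (infmx_mul (infmx_exp B l) M))
        (trunc n) ls.

(* Every part of a composition of m is at most m, so that the compositions of m
   into j parts are j-tuples over 'I_m.+1. *)
Definition is_composition (m j : nat) (l : j.-tuple 'I_m.+1) : bool :=
  [forall i : 'I_j, (0 < tnth l i)%N] && (\sum_(i < j) tnth l i == m)%N.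

Definition cumulant (n m : nat) B : K :=
  m`!%:R *
  \sum_(1 <= j < m.+1) (-1) ^+ j.+1 / j%:R *
    \sum_(l : j.-tuple 'I_m.+1 | is_composition l)
      infmx_tr (trunc_prod n B [seq val i | i <- l]) /
      \prod_(i < j) (tnth l i)`!%:R.

Lemma fsum_trunc (f : nat -> K) (n : nat) :
  (forall k, (n <= k)%N -> f k = 0) ->
  \sum_(k \in [set: nat]) f k = \sum_(k < n) f k.
Proof.
move=> f0; rewrite -(big_mkord xpredT f) /index_iota subn0.
rewrite [RHS]fsbig_seq ?iota_uniq// -(fsbig_widen [set` iota 0 n] [set: nat])//.
move=> k [_] /=; rewrite mem_iota /= add0n => /negP; rewrite -leqNgt.
exact: f0.
Qed.

Lemma infmx_mulE A B (b : nat) :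
  (forall i j : nat, (i + b < j)%N -> A i j = 0) ->
  forall i j, infmx_mul A B i j = \sum_(k < (i + b).+1) A i k * B k j.
Proof.
by move=> Ab i j; apply: fsum_trunc => k /Ab ->; rewrite mul0r.
Qed.

Lemma one_sided_banded_mul A B :
  one_sided_banded A -> one_sided_banded B -> one_sided_banded (infmx_mul A B).
Proof.
move=> [a a0 Aa] [b b0 Bb]; exists (a + b)%N; first by rewrite addn_gt0 a0.
move=> i j ij; rewrite (infmx_mulE _ Aa) big1// => k _.
by rewrite [B _ _]Bb ?mulr0// (leq_ltn_trans _ ij)// addnA leq_add2r -ltnS.
Qed.

Lemma infmx_tr_trunc (n : nat) A :
  infmx_tr (infmx_mul (trunc n) A) = \sum_(k < n) A k k.
Proof.
have PA k : infmx_mul (trunc n) A k k = (k < n)%:R * A k k.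
  rewrite (@infmx_mulE _ _ 0%N) => [|i j]; last first.
    by rewrite addn0 /trunc; case: ltngtP.
  rewrite addn0 (bigD1 ord_max)//= big1 => [|i ik].
    by rewrite addr0 /trunc eqxx.
  rewrite /trunc; case: eqP => [ki|_]; last by rewrite mul0r.
  by case/eqP: ik; apply: val_inj; exact: esym ki.
rewrite /infmx_tr (fsum_trunc (n := n)) => [|k nk].
  by apply: eq_bigr => k _; rewrite PA ltn_ord mul1r.
by rewrite PA ltnNge nk mul0r.
Qed.

End InfiniteMatrices.

(* Main.v *)
Require Import Defs.
From mathcomp Require Import all_boot all_order all_algebra.
From mathcomp Require Import all_classical all_reals all_analysis.
From mathcomp Require Import ring zify.
Set Implicit Arguments.
Unset Strict Implicit.
Unset Printing Implicit Defensive.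
Import Order.TTheory GRing.Theory Num.Theory numFieldNormedType.Exports.
Local Open Scope classical_set_scope.
Local Open Scope ring_scope.

(** Write P_n for the truncation and m for the order of the cumulant.

    The compositions (l_1, ..., l_j) of m, weighted by
    (-1)^(j+1) / (j l_1! ... l_j!), have total weight the coefficient of X^m in
    log (exp X) = X, which is 0 when m >= 2 ([sum_composition_eq0]). Hence the
    number Tr (P_n B^m), which does not depend on the composition, may be
    subtracted from each trace in the definition of the cumulant
    ([cumulantE]).

    The difference Tr (P_n B^l_1 P_n ... B^l_j P_n) - Tr (P_n B^m) only sees
    entries of B close to (n, n). If B vanishes above its b-th superdiagonal,
    a path that starts at a row k with k + m b < n never reaches n in m steps,
    so the truncations do not change row k ([trunc_prod_row]). Thus the
    difference is a sum over the m b diagonal positions just below n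
    ([tr_trunc_prodB]), a number of terms that does not depend on n.

    It remains to follow entries at fixed offsets from the diagonal. Consider
    pairs of families of matrices with a common band such that, at every fixed
    offset, the entries of the first family are bounded and differ from those
    of the second by a null sequence. Such pairs are stable under products
    ([asymp_eq_diag_mul]): the band of the left factor bounds the summation
    index from above and the band of the right factor bounds it from below, so
    that an entry of the product is a sum of a fixed number of local products.
    The truncations and the powers of B form such pairs, hence so do the
    truncated products, and the theorem follows. *)

(** * Asymptotically equal bounded sequences *)

Section AsympEq.
Context {K : numFieldType}.
Implicit Types u v : nat -> K.

Definition eventually_bounded u :=
  exists M : K, exists N : nat, forall n, (N <= n)%N -> `|u n| <= M.

(** Boundedness is only asked of [u], but [v] inherits it. It is what makes the
    relation compatible with products. *)
Definition asymp_eq u v :=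
  eventually_bounded u /\ (fun n => u n - v n) @ \oo --> (0 : K).

Lemma eventually_boundedD u v : eventually_bounded u -> eventually_bounded v ->
  eventually_bounded (fun n => u n + v n).
Proof.
move=> [M [N uM]] [M' [N' vM]]; exists (M + M'), (maxn N N') => n.
rewrite geq_max => /andP[Nn N'n].
by rewrite (le_trans (ler_normD _ _))// lerD// ?uM ?vM.
Qed.

Lemma eventually_boundedM u v : eventually_bounded u -> eventually_bounded v ->
  eventually_bounded (fun n => u n * v n).
Proof.
move=> [M [N uM]] [M' [N' vM]]; exists (M * M'), (maxn N N') => n.
rewrite geq_max => /andP[Nn N'n].
by rewrite normrM ler_pM// ?uM ?vM.
Qed.

Lemma eventually_bounded_mul_cvg0 u v :
  eventually_bounded u -> v @ \oo --> (0 : K) ->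
  (fun n => u n * v n) @ \oo --> (0 : K).
Proof.
move=> [M [N uM]] /cvgr0Pnorm_lt v0; apply/cvgr0Pnorm_lt => e e0.
have M0 : 0 <= M by rewrite (le_trans _ (uM N _)).
have M1 : 0 < M + 1 by rewrite ltr_wpDl.
near=> n; rewrite normrM.
have vn : `|v n| < e / (M + 1) by near: n; apply: v0; rewrite divr_gt0.
have un : `|u n| <= M + 1.
  by rewrite (le_trans (uM n _)) ?lerDl//; near: n; exact: nbhs_infty_ge.
by rewrite (le_lt_trans (ler_wpM2r _ un))// mulrC -ltr_pdivlMr.
Unshelve. all: by end_near. Qed.

Lemma asymp_eq_cst (x : K) : asymp_eq (fun=> x) (fun=> x).
Proof.
split; first by exists `|x|, 0%N.
by under eq_fun do rewrite subrr; exact: cvg_cst.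
Qed.

Lemma asymp_eqD u v u' v' : asymp_eq u u' -> asymp_eq v v' ->
  asymp_eq (fun n => u n + v n) (fun n => u' n + v' n).
Proof.
move=> [ub uu] [vb vv]; split; first exact: eventually_boundedD.
under eq_fun do rewrite opprD addrACA.
by rewrite -[0 : K]addr0; exact: cvgD.
Qed.

Lemma asymp_eqM u v u' v' : asymp_eq u u' -> asymp_eq v v' ->
  asymp_eq (fun n => u n * v n) (fun n => u' n * v' n).
Proof.
move=> [ub uu] [vb vv]; split; first exact: eventually_boundedM.
have -> : (fun n => u n * v n - u' n * v' n) =
    (fun n => u n * (v n - v' n) + v n * (u n - u' n)
              - (u n - u' n) * (v n - v' n)).
  apply/funext => n; rewrite !mulrBr !mulrBl [v n * u n]mulrC [v n * u' n]mulrC.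
  by rewrite !opprB; ring.
have z : (0 : K) = 0 + 0 - 0 * 0 by rewrite mul0r subr0 addr0.
rewrite [X in _ --> X]z; apply: cvgB; last exact: cvgM.
by apply: cvgD; exact: eventually_bounded_mul_cvg0.
Qed.

Lemma asymp_eq_sum (I : Type) (r : seq I) (P : pred I) (u v : I -> nat -> K) :
  (forall i, P i -> asymp_eq (u i) (v i)) ->
  asymp_eq (fun n => \sum_(i <- r | P i) u i n)
           (fun n => \sum_(i <- r | P i) v i n).
Proof.
move=> uv; elim: r => [|i r IH].
  under eq_fun do rewrite big_nil.
  under [X in asymp_eq _ X]eq_fun do rewrite big_nil.
  exact: asymp_eq_cst.
under eq_fun do rewrite big_cons.
under [X in asymp_eq _ X]eq_fun do rewrite big_cons.
by case Pi: (P i) => //; apply: asymp_eqD => //; exact: uv.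
Qed.

(** Both conditions only concern the tails of the sequences. *)
Lemma asymp_eq_shift (s : nat) u v :
  asymp_eq (fun n => u (n + s)%N) (fun n => v (n + s)%N) -> asymp_eq u v.
Proof.
move=> [[M [N uM]] uv]; split.
  exists M, (N + s)%N => n Nn.
  have sn : (s <= n)%N by rewrite (leq_trans _ Nn)// leq_addl.
  by rewrite -(subnK sn) uM// leq_subRL// addnC.
by rewrite -(cvg_shiftn s).
Qed.

End AsympEq.

(** * The algebra of one-sided banded matrices *)

Section Banded.
Context {K : numFieldType}.
Implicit Types A B C : infmx K.

(** Vanishing above the [b]-th superdiagonal; [b = 0] is allowed and means lower
    triangular. *)
Definition banded (b : nat) A := forall i j : nat, (i + b < j)%N -> A i j = 0.

(** The summation range may be any [N] beyond the support of the row. *)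
Lemma infmx_mul_bandedE A C (b i j N : nat) : banded b A -> (i + b < N)%N ->
  infmx_mul A C i j = \sum_(k < N) A i k * C k j.
Proof.
move=> Ab iN; apply: fsum_trunc => k Nk.
by rewrite Ab ?mul0r// (leq_trans iN).
Qed.

Lemma banded_mul A C (a c : nat) : banded a A -> banded c C ->
  banded (a + c) (infmx_mul A C).
Proof.
move=> Aa Cc i j ij; rewrite (infmx_mulE _ Aa) big1// => k _.
by rewrite [C _ _]Cc ?mulr0// (leq_ltn_trans _ ij)// addnA leq_add2r -ltnS.
Qed.

Lemma banded_trunc (n : nat) : banded 0 (trunc n : infmx K).
Proof. by move=> i j; rewrite addn0 /trunc; case: ltngtP. Qed.

Lemma banded_one : banded 0 (infmx_one : infmx K).
Proof. by move=> i j; rewrite addn0 /infmx_one; case: ltngtP. Qed.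

Lemma infmx_mul1 A (b : nat) : banded b A -> infmx_mul A infmx_one = A.
Proof.
move=> Ab; apply/funext => i; apply/funext => j.
have iN : (i + b < (i + b + j).+1)%N by rewrite ltnS leq_addr.
have jN : (j < (i + b + j).+1)%N by rewrite ltnS leq_addl.
rewrite (infmx_mul_bandedE _ _ Ab iN) (bigD1 (Ordinal jN))//= big1 ?addr0.
  by rewrite /infmx_one eqxx mulr1.
move=> k kj; rewrite /infmx_one; case: eqP => [E|]; last by rewrite mulr0.
by case/eqP: kj; exact: val_inj.
Qed.

Lemma infmx_mulA A B C (a b : nat) : banded a A -> banded b B ->
  infmx_mul A (infmx_mul B C) = infmx_mul (infmx_mul A B) C.
Proof.
move=> Aa Bb; apply/funext => i; apply/funext => j.
rewrite (infmx_mulE _ Aa) (infmx_mulE _ (banded_mul Aa Bb)).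
under [RHS]eq_bigr do rewrite (infmx_mulE _ Aa) mulr_suml.
rewrite exchange_big/=; apply: eq_bigr => k _.
have kN : (k + b < (i + (a + b)).+1)%N.
  by rewrite ltnS addnA leq_add2r -ltnS.
rewrite (infmx_mul_bandedE _ _ Bb kN) mulr_sumr.
by apply: eq_bigr => k' _; rewrite mulrA.
Qed.

Lemma trunc_mul (n : nat) A (i j : nat) :
  infmx_mul (trunc n) A i j = (i < n)%:R * A i j.
Proof.
have iN : (i + 0 < i.+1)%N by rewrite addn0.
rewrite (infmx_mul_bandedE _ _ (@banded_trunc n) iN) big_ord_recr/=.
rewrite big1 => [|k _]; first by rewrite add0r /trunc eqxx.
by rewrite /trunc gtn_eqF ?mul0r.
Qed.

Lemma infmx_expS B (b l : nat) : banded b B ->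
  infmx_exp B l.+1 = infmx_mul B (infmx_exp B l).
Proof.
by move=> Bb; case: l => [|l]; rewrite // /infmx_exp /= (infmx_mul1 Bb).
Qed.

Lemma banded_exp B (b l : nat) : banded b B -> banded (l * b) (infmx_exp B l).
Proof.
move=> Bb; elim: l => [|l IH]; first exact: banded_one.
by rewrite (infmx_expS _ Bb) mulSn; exact: banded_mul.
Qed.

Lemma infmx_mul1l A : infmx_mul infmx_one A = A.
Proof.
apply/funext => i; apply/funext => j.
have iN : (i + 0 < i.+1)%N by rewrite addn0.
rewrite (infmx_mul_bandedE _ _ banded_one iN) big_ord_recr/= big1 => [|k _].
  by rewrite add0r /infmx_one eqxx mul1r.
by rewrite /infmx_one gtn_eqF ?mul0r.
Qed.

Lemma infmx_expD B (b l l' : nat) : banded b B ->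
  infmx_exp B (l + l') = infmx_mul (infmx_exp B l) (infmx_exp B l').
Proof.
move=> Bb; elim: l => [|l IH]; first by rewrite infmx_mul1l.
rewrite addSn !(infmx_expS _ Bb) IH.
by rewrite (infmx_mulA _ Bb (banded_exp (l := l) Bb)).
Qed.

(** The rows from which [n] cannot be reached in [sumn ls] steps of height at
    most [b] are not affected by the truncations. *)
Lemma trunc_prod_row (n : nat) B (b : nat) (ls : seq nat) (i j : nat) :
  banded b B -> (i + sumn ls * b < n)%N ->
  trunc_prod n B ls i j = infmx_exp B (sumn ls) i j.
Proof.
move=> Bb; elim: ls i => [|l ls IH] i /=.
  by rewrite mul0n addn0 /trunc /infmx_exp /= /infmx_one => ->; rewrite andbT.
rewrite mulnDl => iN; rewrite trunc_mul (leq_ltn_trans (leq_addr _ _) iN) mul1r.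
rewrite (infmx_expD _ _ Bb) !(infmx_mulE _ (banded_exp (l := l) Bb)).
apply: eq_bigr => k _; rewrite IH// (leq_ltn_trans _ iN)// addnA leq_add2r.
by rewrite -ltnS.
Qed.

Lemma trunc_mul_trunc_prod (n : nat) B (ls : seq nat) :
  infmx_mul (trunc n) (trunc_prod n B ls) = trunc_prod n B ls.
Proof.
apply/funext => i; apply/funext => j; rewrite trunc_mul.
by case: ls => [|l ls] /=; rewrite ?trunc_mul /trunc ?mulrA; case: ltnP => _;
  rewrite ?andbF ?mul1r ?mul0r.
Qed.

(** Locality: the truncations change the trace only through the last
    [sumn ls * b] diagonal entries before the cut. The cut is placed at [n + s]
    so that these entries are those of index [n + k] with [k < s]. *)
Lemma tr_trunc_prodB (n : nat) B (b s : nat) (ls : seq nat) :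
  banded b B -> s = (sumn ls * b)%N ->
  infmx_tr (trunc_prod (n + s) B ls) -
    infmx_tr (infmx_mul (trunc (n + s)) (infmx_exp B (sumn ls))) =
  \sum_(k < s) (trunc_prod (n + s) B ls (n + k)%N (n + k)%N
                - infmx_exp B (sumn ls) (n + k)%N (n + k)%N).
Proof.
move=> Bb sE; rewrite -[in LHS](trunc_mul_trunc_prod (n + s)) !infmx_tr_trunc.
rewrite -sumrB big_split_ord/= big1 ?add0r// => k _.
by rewrite (trunc_prod_row _ Bb) ?subrr// -sE ltn_add2r.
Qed.

End Banded.

(** * Families of matrices that are asymptotically equal near the diagonal *)

Section AsympEqDiag.
Context {K : numFieldType}.
Implicit Types A C : nat -> infmx K.

(** Common band, and asymptotically equal bounded entries at every fixed offset
    from the diagonal. The [n]-th matrix of each family is observed near the position (n, n). The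
    three independent offsets [c], [i], [j], all natural numbers, allow
    positions on either side of the index of the family without any
    subtraction. *)
Definition asymp_eq_diag A A' :=
  (exists b, forall n, banded b (A n) /\ banded b (A' n)) /\
  forall c i j, asymp_eq (fun n => A (n + c)%N (n + i)%N (n + j)%N)
                         (fun n => A' (n + c)%N (n + i)%N (n + j)%N).

(** Near the diagonal an entry of a product is a sum with a number of terms that
    does not depend on [n]. The shift of the row and column by the band [c] of
    the right factor makes room for the intermediate index, which can lie below
    the column index by at most [c]. *)
Lemma infmx_mul_window A C (a c s i j n : nat) :
  (forall m, banded a (A m)) -> (forall m, banded c (C m)) ->
  infmx_mul (A (n + c + s)%N) (C (n + c + s)%N) (n + c + i)%N (n + c + j)%N =
  \sum_(k < (c + i + a).+1)
    A (n + (c + s))%N (n + (c + i))%N (n + k)%N *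
    C (n + (c + s))%N (n + k)%N (n + (c + j))%N.
Proof.
move=> Aa Cc; rewrite -!addnA.
have iN : (n + (c + i) + a < n + (c + (i + a)).+1)%N by lia.
rewrite (infmx_mul_bandedE _ _ (Aa _) iN) big_split_ord/= big1 ?add0r// => k _.
by rewrite [C _ _ _]Cc ?mulr0//; have := ltn_ord k; lia.
Qed.

Lemma asymp_eq_diag_mul A C A' C' :
  asymp_eq_diag A A' -> asymp_eq_diag C C' ->
  asymp_eq_diag (fun n => infmx_mul (A n) (C n))
                (fun n => infmx_mul (A' n) (C' n)).
Proof.
move=> [[a Aa] AA'] [[c Cc] CC']; split.
  exists (a + c)%N => n; have [? ?] := Aa n; have [? ?] := Cc n.
  by split; exact: banded_mul.
move=> s i j; apply: (asymp_eq_shift (s := c)).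
under eq_fun do
  rewrite (infmx_mul_window _ _ _ _ (fun m => (Aa m).1) (fun m => (Cc m).1)).
under [X in asymp_eq _ X]eq_fun do
  rewrite (infmx_mul_window _ _ _ _ (fun m => (Aa m).2) (fun m => (Cc m).2)).
by apply: asymp_eq_sum => k _; exact: asymp_eqM.
Qed.

Lemma asymp_eq_diag_trunc : asymp_eq_diag trunc trunc.
Proof.
split; first by exists 0%N => n; split; exact: banded_trunc.
move=> c i j; rewrite /trunc.
under eq_fun do rewrite eqn_add2l ltn_add2l.
exact: asymp_eq_cst.
Qed.

Lemma asymp_eq_diag_exp (B B' : infmx K) (l : nat) :
  asymp_eq_diag (fun=> B) (fun=> B') ->
  asymp_eq_diag (fun=> infmx_exp B l) (fun=> infmx_exp B' l).
Proof.
move=> BB'; have [[b Bb] _] := BB'; have [Bb1 Bb2] := Bb 0%N.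
elim: l => [|l IH]; last first.
  by rewrite (infmx_expS _ Bb1) (infmx_expS _ Bb2); exact: asymp_eq_diag_mul.
split; first by exists 0%N => n; split; exact: banded_one.
move=> c i j; rewrite /infmx_exp/= /infmx_one.
under eq_fun do rewrite eqn_add2l.
exact: asymp_eq_cst.
Qed.

Lemma asymp_eq_diag_trunc_prod (B B' : infmx K) (ls : seq nat) :
  asymp_eq_diag (fun=> B) (fun=> B') ->
  asymp_eq_diag (fun n => trunc_prod n B ls) (fun n => trunc_prod n B' ls).
Proof.
move=> BB'; elim: ls => [|l ls IH]; first exact: asymp_eq_diag_trunc.
apply: (asymp_eq_diag_mul asymp_eq_diag_trunc).
exact: (asymp_eq_diag_mul (asymp_eq_diag_exp _ BB') IH).
Qed.

Lemma asymp_eq_tr_trunc_prodB (B B' : infmx K) (ls : seq nat) (m : nat) :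
  asymp_eq_diag (fun=> B) (fun=> B') -> sumn ls = m ->
  asymp_eq (fun n => infmx_tr (trunc_prod n B ls) -
                     infmx_tr (infmx_mul (trunc n) (infmx_exp B m)))
           (fun n => infmx_tr (trunc_prod n B' ls) -
                     infmx_tr (infmx_mul (trunc n) (infmx_exp B' m))).
Proof.
move=> BB' <-; have [[b Bb] _] := BB'; have [Bb1 Bb2] := Bb 0%N.
pose s := (sumn ls * b)%N; apply: (asymp_eq_shift (s := s)).
under eq_fun do rewrite (tr_trunc_prodB _ Bb1 (erefl s)).
under [X in asymp_eq _ X]eq_fun do rewrite (tr_trunc_prodB _ Bb2 (erefl s)).
apply: asymp_eq_sum => k _; apply: asymp_eqD.
  exact: (asymp_eq_diag_trunc_prod ls BB').2.
under eq_fun do rewrite -mulN1r.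
under [X in asymp_eq _ X]eq_fun do rewrite -mulN1r.
apply: asymp_eqM; first exact: asymp_eq_cst.
exact: (asymp_eq_diag_exp (sumn ls) BB').2 0%N _ _.
Qed.

End AsympEqDiag.

(** * The weights of the compositions *)

Section Compositions.
Context {K : numFieldType}.

Lemma coef_exp_poly (m j : nat) (c : nat -> K) (k : nat) :
  ((\poly_(i < m.+1) c i) ^+ j)`_k =
  \sum_(l : j.-tuple 'I_m.+1 | (\sum_(i < j) tnth l i == k)%N)
    \prod_(i < j) c (tnth l i).
Proof.
rewrite -[in LHS](card_ord j) -prodr_const poly_def bigA_distr_bigA/=.
rewrite (reindex (fun l : j.-tuple 'I_m.+1 => [ffun i => tnth l i]))/=;
  last first.
  exists (fun f : {ffun 'I_j -> 'I_m.+1} => [tuple f i | i < j]) => [l _|f _].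
    by apply: eq_from_tnth => i; rewrite tnth_mktuple ffunE.
  by apply/ffunP => i; rewrite ffunE tnth_mktuple.
rewrite coef_sum [RHS]big_mkcond/=; apply: eq_bigr => l _.
rewrite (eq_bigr (fun i => c (tnth l i) *: 'X^(tnth l i))) => [|i _].
  by rewrite scaler_prod -expr_sum coefZ coefXn eq_sym; case: eqP;
    rewrite ?mulr1 ?mulr0.
by rewrite ffunE.
Qed.

Lemma coef_exp_eq0 (p : {poly K}) (k n : nat) :
  p`_0 = 0 -> (n < k)%N -> (p ^+ k)`_n = 0.
Proof.
move=> p0 nk; have /factor_theorem[q ->] : root p 0.
  by rewrite /root horner_coef0 p0.
by rewrite subr0 exprMn coefMXn nk.
Qed.

(** The coefficient of X^m in log (exp X) is 0 for [m >= 2]. Both series are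
    truncated after degree [m]: [g] stands for exp X - 1 and [L] for
    log (1 + g). The derivative of [L] is 1 modulo X^m. *)
Lemma sum_composition_eq0 (m : nat) : (2 <= m)%N ->
  \sum_(1 <= j < m.+1) (-1) ^+ j.+1 / j%:R *
    \sum_(l : j.-tuple 'I_m.+1 | is_composition l)
      (\prod_(i < j) (tnth l i)`!%:R)^-1 = 0 :> K.
Proof.
move=> m2.
pose c i : K := if i == 0%N then 0 else i`!%:R^-1.
pose g := \poly_(i < m.+1) c i.
have g0 : g`_0 = 0 by rewrite coef_poly.
have comp j : \sum_(l : j.-tuple 'I_m.+1 | is_composition l)
    (\prod_(i < j) (tnth l i)`!%:R)^-1 = (g ^+ j)`_m.
  rewrite coef_exp_poly big_mkcond [RHS]big_mkcond/=; apply: eq_bigr => l _.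
  rewrite /is_composition; case: ifP => [/andP[/forallP l0 ->]|/negbT].
    rewrite -prodfV; apply: eq_bigr => i _.
    by rewrite /c -(negbK (_ == _)) -lt0n l0.
  rewrite negb_and; case: ifP => //= _; rewrite orbF => /forallPn[i li].
  by rewrite (bigD1 i)//= /c; case: (val _) li; rewrite /= ?mul0r.
under eq_bigr do rewrite comp.
pose L := \sum_(1 <= j < m.+1) ((-1) ^+ j.+1 / j%:R) *: g ^+ j.
have <- : L`_m = \sum_(1 <= j < m.+1) (-1) ^+ j.+1 / j%:R * (g ^+ j)`_m.
  by rewrite coef_sum; apply: eq_bigr => j _; rewrite coefZ.
have dg : g^`() = 1 + g - (m`!%:R)^-1 *: 'X^m.
  apply/polyP => i.
  rewrite coef_deriv coefB coefD coef1 coefZ coefXn !coef_poly !ltnS /c.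
  case: (ltngtP i m) => [im|im|->].
  - rewrite mulr0 subr0.
    case: i im => [|i] im /=; first by rewrite addr0 invr1.
    by rewrite add0r -[LHS]mulr_natr factS natrM invfM mulrAC mulVf
      ?pnatr_eq0// mul1r.
  - rewrite mul0rn mulr0 subr0.
    by rewrite (gtn_eqF (leq_trans _ im))// addr0.
  - rewrite mul0rn mulr1.
    by case: m m2 {g L c comp g0} => // m _; rewrite /= add0r subrr.
have dL : L^`() = (1 - (- g) ^+ m) -
    (m`!%:R)^-1 *: (\sum_(j < m) (- g) ^+ j) * 'X^m.
  (* the derivative of log (1 + Y) is the truncated geometric series in - Y *)
  have -> : L^`() = g^`() * \sum_(j < m) (- g) ^+ j.
    rewrite /L raddf_sum/= big_add1/= big_mkord mulr_sumr.
    apply: eq_bigr => j _; rewrite derivZ deriv_exp/=.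
    rewrite -[X in _ *: X]scaler_nat scalerA mulfVK ?pnatr_eq0//.
    rewrite scalerAr; congr (_ * _).
    by rewrite -[in RHS]scaleN1r exprZn !exprS mulrA mulrNN !mul1r.
  rewrite dg mulrBl; congr (_ - _); last first.
    by rewrite -!scalerAl mulrC.
  rewrite -[(- g) ^+ m](subrK 1) subrX1 opprD addrCA subrr addr0 -mulNr opprB.
  by rewrite opprK.
have : L^`()`_m.-1 = 0.
  rewrite dL !coefB coefMXn prednK ?(ltnW m2)// leqnn subr0 coef1.
  rewrite coef_exp_eq0 ?prednK ?(ltnW m2)//; last by rewrite coefN g0 oppr0.
  by case: m m2 {g L c comp g0 dg dL} => [|[]]//= m _; rewrite subr0.
rewrite coef_deriv prednK ?(ltnW m2)// => /eqP.
by rewrite mulrn_eq0 gtn_eqF ?(ltnW m2)//= => /eqP.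
Qed.
End Compositions.

(** * Cumulants *)

(** For [m >= 2] the weights of the compositions add up to 0, so a quantity that
    does not depend on the composition may be subtracted from the traces. *)
Lemma cumulantE {K : numFieldType} (n m : nat) (B : infmx K) : (2 <= m)%N ->
  cumulant n m B = m`!%:R *
  \sum_(1 <= j < m.+1) (-1) ^+ j.+1 / j%:R *
    \sum_(l : j.-tuple 'I_m.+1 | is_composition l)
      (infmx_tr (trunc_prod n B [seq val i | i <- l]) -
       infmx_tr (infmx_mul (trunc n) (infmx_exp B m))) /
      \prod_(i < j) (tnth l i)`!%:R.
Proof.
move=> m2; rewrite /cumulant; congr (_ * _).
set T := infmx_tr (infmx_mul _ _).
have wT0 := congr1 ( *%R T) (sum_composition_eq0 (K := K) m2).
rewrite mulr0 mulr_sumr in wT0; rewrite -[LHS]subr0 -[X in _ - X]wT0 -sumrB.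
apply: eq_bigr => j _; rewrite mulrCA -mulrBr; congr (_ * _).
by rewrite [T * _]mulr_sumr -sumrB; apply: eq_bigr => l _; rewrite mulrBl.
Qed.

Lemma sumn_composition (m j : nat) (l : j.-tuple 'I_m.+1) :
  is_composition l -> sumn [seq val i | i <- l] = m.
Proof.
by move=> /andP[_ /eqP lm]; rewrite sumnE big_map big_tuple.
Qed.

Theorem theorem3p2 (K : numFieldType) (B1 B2 : infmx K)
  (hB1 : one_sided_banded B1) (hB2 : one_sided_banded B2)
  (hbounded : bounded_diagonals B1)
  (hclose : forall i j : nat,
     (fun n : nat => `|B1 (n + i)%N (n + j)%N - B2 (n + i)%N (n + j)%N|)
       @ \oo --> (0 : K))
  (m : nat) (hm : (2 <= m)%N) :
  (fun n : nat => `|cumulant n m B1 - cumulant n m B2|) @ \oo --> (0 : K).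
Proof.
have BB : asymp_eq_diag (fun=> B1) (fun=> B2).
  split=> [|_ i j].
    have [b1 _ Bb1] := hB1; have [b2 _ Bb2] := hB2.
    exists (b1 + b2)%N => _.
    by split=> i j ij; [apply: Bb1 | apply: Bb2]; lia.
  split; first by have [M BM] := hbounded i j; exists M, 0%N.
  by apply/norm_cvg0P; exact: hclose.
apply/norm_cvg0P.
suff [] : asymp_eq (fun n => cumulant n m B1) (fun n => cumulant n m B2) by [].
under eq_fun do rewrite (cumulantE _ _ hm).
under [X in asymp_eq _ X]eq_fun do rewrite (cumulantE _ _ hm).
apply: asymp_eqM; first exact: asymp_eq_cst.
apply: asymp_eq_sum => j _; apply: asymp_eqM; first exact: asymp_eq_cst.
apply: asymp_eq_sum => l lm.
apply: asymp_eqM; last exact: asymp_eq_cst.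
exact: asymp_eq_tr_trunc_prodB (sumn_composition lm).
Qed.
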